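(* Let $m\ge 1$ and $n>2m$ be integers, and let $H_{2m,n}$ be the Harary graph. Then $\gamma_{\times 2,t}(H_{2m,n}) = \left\lceil \frac{n}{m}\right\rceil$.
   Context: All graphs are finite and simple; $N(x)$ denotes the open neighborhood of a vertex $x$. For a graph $G$ with minimum degree at least $2$, a subset $S\subseteq V(G)$ is a double total dominating set (2TDS) of $G$ if $|N(x)\cap S|\ge 2$ for every $x\in V(G)$. The double total domination number $\gamma_{\times 2,t}(G)$ is the minimum cardinality of a double total dominating set of $G$. Harary graph $H_{p,q}$ with $p$ even and $p<q$: place $q$ vertices $1,2,\dots,q$ around a circle, equally spaced, and make each vertex adjacent to the nearest $\frac{p}{2}$ vertices in each direction around the circle. *)

(* Defs.v *)
From mathcomp Require Import all_boot.

Set Implicit Arguments.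
Unset Strict Implicit.
Unset Printing Implicit Defensive.

Record sgraph := SGraph {
  vertex :> finType;
  adj : rel vertex;
  adj_sym : symmetric adj;
  adj_irrefl : irreflexive adj
}.

Definition open_nbhd (G : sgraph) (x : G) : {set G} := [set y | adj x y].

Definition min_degree_ge (G : sgraph) (d : nat) : bool :=
  [forall x : G, d <= #|open_nbhd x|].

Definition double_total_dominating (G : sgraph) (S : {set G}) : bool :=
  [forall x : G, 2 <= #|open_nbhd x :&: S|].

(* The default [set: G] of the arg min is itself a double total dominating set
   as soon as the minimum degree is at least 2, so in that case this is a
   genuine minimum: see double_total_domination_numberP.  Graphs of smaller
   minimum degree have no such set, and get the junk value #|G|. *)
Definition double_total_domination_number (G : sgraph) : nat :=
  #|[arg min_(S < [set: G] | double_total_dominating S) #|S|]|.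

Lemma double_total_domination_numberP (G : sgraph) :
  min_degree_ge G 2 ->
  (exists2 S : {set G}, double_total_dominating S &
     #|S| = double_total_domination_number G) /\
  (forall S : {set G}, double_total_dominating S ->
     double_total_domination_number G <= #|S|).
Proof.
move=> /forallP degG.
have domT : double_total_dominating [set: G].
  by apply/forallP => x; rewrite setIT.
rewrite /double_total_domination_number.
by case: arg_minnP => // S domS minS; split=> //; exists S.
Qed.

(* Number of steps from x to y going around the circle in the increasing
   direction. *)
Definition cw_dist (q : nat) (x y : 'I_q) : nat := (y + (q - x)) %% q.

(* The vertices 1, ..., q of the circle are numbered 0, ..., q - 1. The
   definition is meant for even p < q. *)
Definition harary_adj (p q : nat) : rel 'I_q :=
  fun x y => (0 < cw_dist x y <= p./2) || (0 < cw_dist y x <= p./2).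

Lemma harary_adj_sym (p q : nat) : symmetric (@harary_adj p q).
Proof. by move=> x y; rewrite /harary_adj orbC. Qed.

Lemma harary_adj_irrefl (p q : nat) : irreflexive (@harary_adj p q).
Proof.
by move=> x; rewrite /harary_adj /cw_dist subnKC ?modnn // ltnW.
Qed.

Definition harary (p q : nat) : sgraph :=
  SGraph (@harary_adj_sym p q) (@harary_adj_irrefl p q).

Lemma harary_min_degree (m n : nat) :
  1 <= m -> 2 * m < n -> min_degree_ge (harary (2 * m) n) 2.
Proof.
move=> m1 mn; have n2 : 2 < n by apply: leq_trans mn; rewrite ltnS leq_pmulr.
have n0 : 0 < n by apply: leq_trans n2.
apply/forallP => x /=; have xn : x < n := ltn_ord x.
pose s := Ordinal (ltn_pmod (x + 1) n0).
pose t := Ordinal (ltn_pmod (x + (n - 1)) n0).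
have ds : cw_dist x s = 1.
  by rewrite /cw_dist /= modnDml addnAC subnKC 1?ltnW // modnDl modn_small // ltnW.
have dt : cw_dist x t = n - 1.
  rewrite /cw_dist /= modnDml addnAC subnKC 1?ltnW // modnDl modn_small //.
  by rewrite subn1 prednK.
have dt' : cw_dist t x = 1.
  rewrite /cw_dist /=; case: (posnP x) => [x0|x0].
    have n1 : n - 1 < n by rewrite subn1 prednK.
    by rewrite x0 !add0n (modn_small n1) subKn // modn_small // ltnW.
  have -> : x + (n - 1) = x.-1 + n by rewrite subn1 -{1}(prednK x0) addSnnS prednK.
  have xn' : x.-1 < n by apply: leq_ltn_trans xn; apply: leq_pred.
  rewrite modnDr (modn_small xn') -{1}(prednK x0) addSn subnKC.
    by rewrite -addn1 modnDl modn_small // ltnW.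
  exact: ltnW.
have st : s != t.
  apply/eqP => e; move: ds; rewrite e dt => /eqP.
  by rewrite -(eqn_add2r 1) subnK // => /eqP e2; rewrite e2 in n2.
have xs : harary_adj (2 * m) x s by rewrite /harary_adj ds mul2n doubleK m1.
have xt : harary_adj (2 * m) x t.
  by rewrite /harary_adj dt' mul2n doubleK m1 orbT.
have c2 : 2 <= #|[set s; t]| by rewrite cards2 st.
apply: (leq_trans c2); apply: subset_leq_card; apply/subsetP => y.
by rewrite !inE => /orP [] /eqP ->.
Qed.

(* Main.v *)
(* Lower bound: every vertex has at most 2m neighbours, so counting the edges
   between V and S in two ways gives 2n <= 2m|S|.  Upper bound: the multiples of
   m form a set whose circular gaps are at most m, so it meets both the m
   vertices after x and the m vertices before x; these two windows are disjoint
   because 2m < n. *)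
Require Import Defs.
From mathcomp Require Import all_boot all_order all_algebra.
From mathcomp Require Import zify.

Set Implicit Arguments.
Unset Strict Implicit.
Unset Printing Implicit Defensive.

Lemma double_total_dominating_degree_bound (G : sgraph) (d : nat) (S : {set G}) :
  (forall x : G, #|open_nbhd x| <= d) -> double_total_dominating S ->
  2 * #|G| <= d * #|S|.
Proof.
(* Both sides become constant sums, of 2 over all vertices and of [d] over [S], each compared
   termwise with the count of adjacent pairs. *)
move=> degG /forallP domS; rewrite mulnC -sum_nat_const mulnC -sum_nat_const.
apply: (@leq_trans (\sum_(x : G) \sum_(y in S | adj x y) 1)).
  apply: leq_sum => x _; rewrite sum1dep_card; apply: leq_trans (domS x) _.
  by apply/eq_leq/eq_card => y; rewrite !inE andbC.
rewrite (exchange_big_dep [in S]) /= => [|x y _ /andP[] //].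
apply: leq_sum => y yS; rewrite sum1dep_card; apply: leq_trans (degG y).
by apply/eq_leq/eq_card => x; rewrite !inE yS adj_sym.
Qed.

(** Without the modulus, goals about circular distance become linear arithmetic. *)
Lemma cw_distE (n : nat) (x y : 'I_n) :
  cw_dist x y = if x <= y then y - x else y + n - x.
Proof.
have [xn yn] := (ltn_ord x, ltn_ord y); rewrite /cw_dist; case: leqP => xy.
  have -> : y + (n - x) = y - x + n by lia.
  by rewrite modnDr modn_small //; lia.
by rewrite modn_small; lia.
Qed.

Lemma harary_degree_le (m n : nat) (x : harary (2 * m) n) :
  #|open_nbhd x| <= 2 * m.
Proof.
have n0 : 0 < n by apply: leq_ltn_trans (ltn_ord x).
(* [f] and [g] move k+1 steps forward and backward from [x]. Each neighbour is reached with k+1 its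
   circular distance; this is below [n], so the subtraction in [g] does not truncate there. *)
pose f (k : 'I_m) := Ordinal (ltn_pmod (x + k.+1) n0).
pose g (k : 'I_m) := Ordinal (ltn_pmod (x + n - k.+1) n0).
apply: (@leq_trans #|(f @: 'I_m) :|: (g @: 'I_m)|); last first.
  apply: leq_trans (leq_card_setU _ _) _; rewrite mul2n -addnn.
  by apply: leq_add; apply: leq_trans (leq_imset_card _ _) _; rewrite card_ord.
apply: subset_leq_card; apply/subsetP => y; rewrite !inE /= /harary_adj.
have [xn yn] := (ltn_ord x, ltn_ord y).
rewrite mul2n doubleK => /orP[] /andP[d0 dm]; apply/orP; [left|right];
  have km : (cw_dist _ _).-1 < m := leq_trans (eq_leq (prednK d0)) dm;
  apply/imsetP; exists (Ordinal km) => //; apply: val_inj => /=;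
  rewrite prednK //; move: d0; rewrite cw_distE; case: ifP => xy d0.
- by rewrite subnKC ?modn_small.
- have -> : x + (y + n - x) = y + n by lia.
  by rewrite modnDr modn_small.
- have -> : x + n - (x - y) = y + n by lia.
  by rewrite modnDr modn_small.
- have -> : x + n - (x + n - y) = y by lia.
  by rewrite modn_small.
Qed.

Definition multiples (m n : nat) : {set 'I_n} := [set x : 'I_n | m %| x].

Lemma card_multiples_le (m n : nat) :
  0 < m -> 0 < n -> #|multiples m n| <= (n.-1 %/ m).+1.
Proof.
move=> m0 n0; pose f (k : 'I_(n.-1 %/ m).+1) := Ordinal (ltn_pmod (k * m) n0).
suff /subset_leq_card sub : multiples m n \subset f @: 'I_(n.-1 %/ m).+1.
  by apply: leq_trans sub (leq_trans (leq_imset_card _ _) _); rewrite card_ord.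
apply/subsetP => x; rewrite inE => mx; have xn := ltn_ord x.
have kK : x %/ m < (n.-1 %/ m).+1 by rewrite ltnS leq_div2r //; lia.
apply/imsetP; exists (Ordinal kK) => //; apply: val_inj => /=.
by rewrite divnK // modn_small.
Qed.

Lemma multiples_cw_after (m n : nat) (x : 'I_n) :
  0 < m -> m < n -> exists2 s, s \in multiples m n & 0 < cw_dist x s <= m.
Proof.
move=> m0 mn; have xn := ltn_ord x; have n0 : 0 < n by lia.
have := divn_eq x m; have := ltn_pmod x m0 => rm xE.
(* Take the first multiple of [m] beyond [x]; if it reaches [n], wrap around to 0, which is then n -
   x <= m steps away. *)
have [sn|ns] := ltnP ((x %/ m).+1 * m) n.
  exists (Ordinal sn); rewrite ?inE /= ?dvdn_mull // cw_distE /=.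
  by case: ifP; lia.
exists (Ordinal n0); rewrite ?inE /= ?dvdn0 // cw_distE /=.
by case: ifP; lia.
Qed.

Lemma multiples_cw_before (m n : nat) (x : 'I_n) :
  0 < m -> m < n -> exists2 t, t \in multiples m n & 0 < cw_dist t x <= m.
Proof.
move=> m0 mn; have xn := ltn_ord x.
(* [z] is the circular predecessor of [x]; rounding it down to a multiple of [m] adds at most m-1
   steps to the first one. *)
pose z := if x == 0 :> nat then n.-1 else x.-1.
have := divn_eq z m; have := ltn_pmod z m0 => rm zE.
have tn : z %/ m * m < n by move: zE; rewrite /z; case: eqP; lia.
exists (Ordinal tn); rewrite ?inE /= ?dvdn_mull // cw_distE /=.
by move: zE; rewrite /z; case: eqP => x0; case: ifP; lia.
Qed.

Lemma multiples_dominating (m n : nat) :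
  0 < m -> 2 * m < n ->
  @double_total_dominating (harary (2 * m) n) (multiples m n).
Proof.
move=> m0 mn; have mn' : m < n by lia.
apply/forallP => /= x.
have [s sS xs] := multiples_cw_after x m0 mn'.
have [t tS tx] := multiples_cw_before x m0 mn'.
(* If s = t, the two positive distances would complete a full turn, giving n <= 2m. *)
have st : s != t.
  apply/eqP => e; have := ltn_ord x; have := ltn_ord t.
  by move: xs tx; rewrite e !cw_distE; do 2![case: ifP]; lia.
have c2 : 2 <= #|[set s; t]| by rewrite cards2 st.
apply: leq_trans c2 (subset_leq_card _); apply/subsetP => y; rewrite !inE /= /harary_adj.
rewrite mul2n doubleK => /orP[] /eqP->; move: sS tS; rewrite !inE => sS tS.
  by rewrite xs sS.
by rewrite tx tS orbT.
Qed.

Lemma double_total_domination_number_harary (m n : nat) :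
  0 < m -> 2 * m < n ->
  double_total_domination_number (harary (2 * m) n) = (n.-1 %/ m).+1.
Proof.
move=> m0 mn.
have [[S domS cardS] minS] :=
  double_total_domination_numberP (harary_min_degree m0 mn).
apply/eqP; rewrite eqn_leq; apply/andP; split.
  apply: leq_trans (card_multiples_le m0 (leq_ltn_trans (leq0n _) mn)).
  exact: minS (multiples_dominating m0 mn).
rewrite -cardS.
have := double_total_dominating_degree_bound (@harary_degree_le m n) domS.
(* Cancelling 2 leaves n <= m|S|, that is n-1 < m|S|, so the quotient of n-1 by [m] is below |S|. *)
by rewrite card_ord -mulnA leq_pmul2l // ltn_divLR // mulnC; lia.
Qed.

Lemma ceil_divn (m n : nat) :
  0 < m -> 0 < n -> Num.ceil (n%:Q / m%:Q)%R = (n.-1 %/ m).+1%:Z%R.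
Proof.
(* With q the quotient of n-1 by [m], clearing denominators leaves qm < n <= (q+1)m, which is
   Euclidean division of n-1. *)
move=> m0 n0; apply: Num.Theory.ceil_def.
have m0Q : (0 < m%:Q)%R by rewrite Num.Theory.ltr0n.
rewrite Num.Theory.ltr_pdivlMr // Num.Theory.ler_pdivrMr //.
rewrite -!intrM ltr_int ler_int.
by have := divn_eq n.-1 m; have := ltn_pmod n.-1 m0; nia.
Qed.

Theorem theorem2p2 (m n : nat) (hm : (1 <= m)%N) (hn : (2 * m < n)%N) :
  (double_total_domination_number (harary (2 * m)%N n))%:Z%R
  = Num.ceil (n%:Q / m%:Q)%R.

Proof.
rewrite double_total_domination_number_harary // ceil_divn //.
exact: leq_ltn_trans hn.
Qed.
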